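(* Let $K$ be a commutative unital ring and let $\theta$ be a unital action of an $E$-unitary inverse monoid $S$ on a unital associative $K$-algebra $A$. Then $A\rtimes_\theta S\cong A\rtimes_{\tilde\theta}\mathcal G(S)$ as $K$-algebras.
   Context: Inverse monoids. For an inverse monoid $S$, $E(S)$ is its set of idempotents and $s\le t$ means $s=et$ for some $e\in E(S)$. $S$ is $E$-unitary if $e\le s$ with $e\in E(S)$ implies $s\in E(S)$. The minimum group congruence $\sigma$ on $S$ is: $(s,t)\in\sigma$ iff there is $u\in S$ with $u\le s$ and $u\le t$. $\mathcal G(S)=S/\sigma$ is the maximum group image of $S$; its elements are $\sigma$-classes. Actions. $\mathcal I(A)$ is the symmetric inverse monoid of all bijections between subsets of $A$. A unital action of $S$ on $A$ is a semigroup homomorphism $\theta:S\to\mathcal I(A)$, $s\mapsto\theta_s$, such that the domain and range of each $\theta_s$ are ideals of $A$, $\theta_s$ is an isomorphism of $K$-algebras from its domain onto its range, $\theta_{1_S}=\mathrm{id}_A$, and the range of $\theta_s$ is $1_sA$ for some central idempotent $1_s$ of $A$ (so $\theta_s:1_{s^{-1}}A\to 1_sA$). When $S$ is $E$-unitary, any such action is compatible: for all $(s,t)\in\sigma$ the maps $\theta_s$ and $\theta_t$ agree on the intersection of their domains. Crossed product. $L(A,\theta,S)=\bigoplus_{s\in S}1_sA\,\delta_s$ ($\delta_s$ are symbols) with product $a\delta_s\cdot b\delta_t=a\,\theta_s(1_{s^{-1}}b)\,\delta_{st}$ is an associative $K$-algebra; $\mathcal N$ is its ideal generated by all $a\delta_s-a\delta_t$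 with $s\le t$ and $a\in 1_sA$; $A\rtimes_\theta S=L(A,\theta,S)/\mathcal N$. Induced partial action and skew group algebra. For a compatible action and $g\in\mathcal G(S)$ let $\mathcal D_g=\sum_{s\in g}1_sA$ and $\tilde\theta_g:\mathcal D_{g^{-1}}\to\mathcal D_g$, $\tilde\theta_g(\sum_{s\in g}a_{s^{-1}})=\sum_{s\in g}\theta_s(a_{s^{-1}})$ with $a_{s^{-1}}\in 1_{s^{-1}}A$ (finite sums); these maps are well defined and form a partial action $\tilde\theta$ of the group $\mathcal G(S)$ on $A$. The skew group algebra is $A\rtimes_{\tilde\theta}\mathcal G(S)=\bigoplus_{g\in\mathcal G(S)}\mathcal D_g\delta_g$ with product $a\delta_g\cdot b\delta_h=\tilde\theta_g(\tilde\theta_g^{-1}(a)b)\delta_{gh}$. *)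

(* Defs.v *)
From HB Require Import structures.
From mathcomp Require Import all_boot all_order all_algebra all_classical.

Set Implicit Arguments.
Unset Strict Implicit.
Unset Printing Implicit Defensive.

Import GRing.Theory.

Local Open Scope quotient_scope.
Local Open Scope classical_set_scope.
Local Open Scope ring_scope.

(* algType requires 1 != 0; a kalgType is a unital associative K-algebra that *)
(* may be the zero algebra.                                                   *)
HB.mixin Record PzRing_isKAlgebra (K : comPzRingType) A of GRing.PzRing A := {
  kscale : K -> A -> A;
  kscaleA : forall a b v, kscale a (kscale b v) = kscale (a * b) v;
  kscale1 : left_id 1 kscale;
  kscaleDr : right_distributive kscale +%R;
  kscaleDl : forall v, {morph kscale^~ v : a b / a + b};
  kscaleAl : forall k (x y : A), kscale k (x * y) = kscale k x * y;
  kscaleAr : forall k (x y : A), kscale k (x * y) = x * kscale k y }.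

#[short(type="kalgType")]
HB.structure Definition KAlgebra (K : comPzRingType) :=
  { A of GRing.PzRing A & PzRing_isKAlgebra K A }.

HB.instance Definition _ (K : comPzRingType) (A : kalgType K) :=
  GRing.Zmodule_isLmodule.Build K (KAlgebra.sort A)
    (@kscaleA K A) (@kscale1 K A) (@kscaleDr K A) (@kscaleDl K A).

Definition kalg_isomorphic (K : comPzRingType) (A B : kalgType K) : Prop :=
  exists f : {rmorphism A -> B}, scalable f /\ bijective f.

Section KAlgebraTheory.
Variables (K : comPzRingType) (A : kalgType K).
Implicit Types (k : K) (x y e : A).

Lemma kscalerAl k x y : k *: (x * y) = k *: x * y.
Proof. exact: kscaleAl. Qed.

Lemma kscalerAr k x y : k *: (x * y) = x * (k *: y).
Proof. exact: kscaleAr. Qed.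

(* Stability under K follows from that under multiplication by k *: 1. *)
Definition two_sided_ideal (J : set A) : Prop :=
  [/\ J 0, forall x y, J x -> J y -> J (x - y)
    & forall a x, J x -> J (a * x) /\ J (x * a)].

Definition generated_ideal (X : set A) : set A :=
  [set x | forall J, two_sided_ideal J -> X `<=` J -> J x].

Definition central_idempotent e : Prop :=
  e * e = e /\ forall x, e * x = x * e.

Lemma generated_ideal_two_sided X : two_sided_ideal (generated_ideal X).
Proof.
split=> [J [] //|x y Xx Xy J JI JX|a x Xx]; first by
  case: (JI) => _ JB _; apply: JB; [apply: Xx|apply: Xy].
by split=> J JI JX; case: (JI) => _ _ /(_ a x (Xx J JI JX)) [].
Qed.

End KAlgebraTheory.

Section Quotient.
Variables (K : comPzRingType) (A : kalgType K) (X : set A).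

Definition gen_ideal_pred : {pred A} := fun x => `[< generated_ideal X x >].

Fact gen_ideal_zmod_closed : zmod_closed gen_ideal_pred.
Proof.
have [J0 JB _] := generated_ideal_two_sided X.
by split=> [|x y /asboolP Xx /asboolP Xy]; apply/asboolP => //; apply: JB.
Qed.

HB.instance Definition _ :=
  GRing.isZmodClosed.Build A gen_ideal_pred gen_ideal_zmod_closed.

Definition quotient_algebra : Type := Quotient.quot gen_ideal_pred.

HB.instance Definition _ := GRing.Zmodule.on quotient_algebra.

Local Notation Q := quotient_algebra.
Local Notation pi := (\pi_(Quotient.quot gen_ideal_pred) : A -> Q).

Definition quotient_mul (x y : Q) : Q := pi (repr x * repr y).
Definition quotient_scale (k : K) (x : Q) : Q := pi (k *: repr x).

Lemma quotient_eqP (x y : A) : pi x = pi y <-> generated_ideal X (x - y).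
Proof.
by split=> [/eqP|h]; [|apply/eqP]; rewrite -Quotient.idealrBE; [move/asboolP|apply/asboolP].
Qed.

Lemma quotient_reprP (x : A) : generated_ideal X (repr (pi x) - x).
Proof. by apply/quotient_eqP; rewrite reprK. Qed.

Lemma pi_quotient_mul (x y : A) : pi (x * y) = quotient_mul (pi x) (pi y).
Proof.
apply/esym/quotient_eqP; set x' := repr _; set y' := repr _.
have -> : x' * y' - x * y = (x' - x) * y' - (- x) * (y' - y).
  by rewrite mulrBl mulNr opprK mulrBr addrA subrK.
have [_ JB JM] := generated_ideal_two_sided X.
by apply: JB; [have [] := JM y' _ (quotient_reprP x)
              |have [] := JM (- x) _ (quotient_reprP y)].
Qed.

Lemma pi_quotient_scale k (x : A) : pi (k *: x) = quotient_scale k (pi x).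
Proof.
apply/esym/quotient_eqP; have [_ _ JM] := generated_ideal_two_sided X.
rewrite -scalerBr -[_ - _]mul1r kscalerAl.
by have [] := JM (k *: (1 : A)) _ (quotient_reprP x).
Qed.

Lemma pi_quotient_add (x y : A) : pi (x + y) = pi x + pi y.
Proof. exact: (raddfD (\pi_(Quotient.quot gen_ideal_pred))). Qed.

Lemma quotient_ind (P : Q -> Prop) : (forall x, P (pi x)) -> forall x, P x.
Proof. by move=> h x; rewrite -[x]reprK; apply: h. Qed.

Fact quotient_mulA : associative quotient_mul.
Proof.
elim/quotient_ind=> x; elim/quotient_ind=> y; elim/quotient_ind=> z.
by rewrite -!pi_quotient_mul mulrA.
Qed.

Fact quotient_mul1 : left_id (pi 1) quotient_mul.
Proof. by elim/quotient_ind=> x; rewrite -pi_quotient_mul mul1r. Qed.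

Fact quotient_1mul : right_id (pi 1) quotient_mul.
Proof. by elim/quotient_ind=> x; rewrite -pi_quotient_mul mulr1. Qed.

Fact quotient_mulDl : left_distributive quotient_mul +%R.
Proof.
elim/quotient_ind=> x; elim/quotient_ind=> y; elim/quotient_ind=> z.
by rewrite -pi_quotient_add -!pi_quotient_mul mulrDl pi_quotient_add.
Qed.

Fact quotient_mulDr : right_distributive quotient_mul +%R.
Proof.
elim/quotient_ind=> x; elim/quotient_ind=> y; elim/quotient_ind=> z.
by rewrite -pi_quotient_add -!pi_quotient_mul mulrDr pi_quotient_add.
Qed.

HB.instance Definition _ := GRing.Zmodule_isPzRing.Build Q
  quotient_mulA quotient_mul1 quotient_1mul quotient_mulDl quotient_mulDr.

Fact quotient_scaleA a b v :
  quotient_scale a (quotient_scale b v) = quotient_scale (a * b) v.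
Proof.
by move: v; elim/quotient_ind=> x; rewrite -!pi_quotient_scale scalerA.
Qed.

Fact quotient_scale1 : left_id 1 quotient_scale.
Proof. by elim/quotient_ind=> x; rewrite -pi_quotient_scale scale1r. Qed.

Fact quotient_scaleDr : right_distributive quotient_scale +%R.
Proof.
move=> k; elim/quotient_ind=> x; elim/quotient_ind=> y.
by rewrite -pi_quotient_add -!pi_quotient_scale scalerDr pi_quotient_add.
Qed.

Fact quotient_scaleDl v : {morph quotient_scale^~ v : a b / a + b}.
Proof.
move: v; elim/quotient_ind=> x a b.
by rewrite -!pi_quotient_scale scalerDl pi_quotient_add.
Qed.

Fact quotient_scaleAl k (x y : Q) :
  quotient_scale k (quotient_mul x y) = quotient_mul (quotient_scale k x) y.
Proof.
move: x y; elim/quotient_ind=> x; elim/quotient_ind=> y.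
by rewrite -!(pi_quotient_mul, pi_quotient_scale) kscalerAl.
Qed.

Fact quotient_scaleAr k (x y : Q) :
  quotient_scale k (quotient_mul x y) = quotient_mul x (quotient_scale k y).
Proof.
move: x y; elim/quotient_ind=> x; elim/quotient_ind=> y.
by rewrite -!(pi_quotient_mul, pi_quotient_scale) kscalerAr.
Qed.

HB.instance Definition _ := PzRing_isKAlgebra.Build K Q
  quotient_scaleA quotient_scale1 quotient_scaleDr quotient_scaleDl
  quotient_scaleAl quotient_scaleAr.

End Quotient.

HB.mixin Record Monoid_isInverse S of monoid.Monoid S := {
  sinv : S -> S;
  mulsVs : forall s : S, (s * sinv s * s = s)%g;
  mulVsV : forall s : S, (sinv s * s * sinv s = sinv s)%g;
  sinv_uniq : forall s t : S, (s * t * s = s -> t * s * t = t -> t = sinv s)%g }.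

#[short(type="inverseMonoidType")]
HB.structure Definition InverseMonoid :=
  { S of monoid.Monoid S & Monoid_isInverse S }.

Local Notation "s ^*" := (sinv s) : group_scope.

Section InverseMonoidTheory.
Variable S : inverseMonoidType.
Implicit Types s t u e f : S.
Local Open Scope group_scope.

Definition idempotent_elt e : Prop := e * e = e.

Definition nat_le s t : Prop := exists2 e, idempotent_elt e & s = e * t.

Definition E_unitary : Prop :=
  forall e s, idempotent_elt e -> nat_le e s -> idempotent_elt s.

Definition sigma s t : Prop := exists2 u, nat_le u s & nat_le u t.

Lemma sinvK : involutive (@sinv S).
Proof. by move=> s; apply/esym/sinv_uniq; rewrite (mulsVs, mulVsV). Qed.

Lemma sinv_idem e : idempotent_elt e -> e^* = e.
Proof. by move=> ee; apply/esym/sinv_uniq; rewrite !ee. Qed.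

Lemma idem_mulsV s : idempotent_elt (s * s^*).
Proof. by rewrite /idempotent_elt mulgA mulsVs. Qed.

Lemma idem_mulVs s : idempotent_elt (s^* * s).
Proof. by rewrite /idempotent_elt mulgA mulVsV. Qed.

Lemma idemM e f : idempotent_elt e -> idempotent_elt f -> idempotent_elt (e * f).
Proof.
move=> ee ff; set x := (e * f)^*.
have xE : f * x * e = x.
  apply: sinv_uniq.
    rewrite !mulgA -(mulgA _ f f) ff -(mulgA _ e e) ee.
    by have := mulsVs (e * f); rewrite !mulgA.
  rewrite !mulgA -(mulgA _ e e) ee -(mulgA _ f f) ff.
  by have := congr1 (fun z => f * z * e) (mulVsV (e * f)); rewrite !mulgA.
have xx : idempotent_elt x.
  rewrite /idempotent_elt -{1 2}xE !mulgA.
  have := congr1 (fun z => f * z * e) (mulVsV (e * f)).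
  by rewrite !mulgA => ->.
have : e * f = x^* by rewrite sinvK.
by rewrite (sinv_idem xx) => ->.
Qed.

Lemma idemC e f : idempotent_elt e -> idempotent_elt f -> e * f = f * e.
Proof.
move=> ee ff; have efI := idemM ee ff; have feI := idemM ff ee.
rewrite -[LHS](sinv_idem efI); apply/esym/sinv_uniq.
  by rewrite !mulgA -(mulgA _ f f) ff -(mulgA _ e e) ee -!mulgA; have := efI; rewrite /idempotent_elt !mulgA.
by rewrite !mulgA -(mulgA _ e e) ee -(mulgA _ f f) ff -!mulgA; have := feI; rewrite /idempotent_elt !mulgA.
Qed.

Lemma sinvM s t : (s * t)^* = t^* * s^*.
Proof.
have C := idemC (idem_mulsV t) (idem_mulVs s).
apply/esym/sinv_uniq.
  have -> : s * t * (t^* * s^*) * (s * t) = s * ((t * t^*) * (s^* * s)) * t.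
    by rewrite !mulgA.
  by rewrite C !mulgA mulsVs -(mulgA s t) -(mulgA s) mulsVs.
have -> : t^* * s^* * (s * t) * (t^* * s^*) = t^* * ((s^* * s) * (t * t^*)) * s^*.
  by rewrite !mulgA.
by rewrite -C !mulgA mulVsV -(mulgA t^* s^*) -(mulgA t^*) mulVsV.
Qed.

Lemma idem_conj s e : idempotent_elt e -> idempotent_elt (s * e * s^*).
Proof.
move=> ee; rewrite /idempotent_elt.
have -> : s * e * s^* * (s * e * s^*) = s * (e * (s^* * s)) * e * s^*.
  by rewrite !mulgA.
by rewrite (idemC ee (idem_mulVs s)) !mulgA mulsVs -(mulgA s) ee.
Qed.

Lemma idem_slide s e : idempotent_elt e -> s * e = s * e * s^* * s.
Proof.
move=> ee; rewrite -{1}(mulsVs s) -mulgA -mulgA (mulgA s^*).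
by rewrite -(idemC ee (idem_mulVs s)) !mulgA.
Qed.

Lemma idem1 : idempotent_elt (1 : S).
Proof. exact: mulg1. Qed.

Lemma nat_le_refl s : nat_le s s.
Proof. by exists 1; [exact: idem1|rewrite mul1g]. Qed.

Lemma nat_le_trans s t u : nat_le s t -> nat_le t u -> nat_le s u.
Proof.
move=> [e ee ->] [f ff ->]; exists (e * f); first exact: idemM.
by rewrite mulgA.
Qed.

Lemma nat_le_mul s s' t t' : nat_le s s' -> nat_le t t' -> nat_le (s * t) (s' * t').
Proof.
move=> [e ee ->] [f ff ->]; exists (e * (s' * f * s'^*)).
  by apply: idemM => //; exact: idem_conj.
by rewrite !mulgA -(mulgA e s' f) {1}(idem_slide s' ff) !mulgA.
Qed.

Lemma nat_le_sinv s t : nat_le s t -> nat_le s^* t^*.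
Proof.
move=> [e ee ->]; exists (t^* * e * t); first by rewrite -{2}(sinvK t); exact: idem_conj.
by rewrite sinvM (sinv_idem ee) [LHS](idem_slide t^* ee) sinvK.
Qed.

Lemma sigma_refl s : sigma s s.
Proof. by exists s; exact: nat_le_refl. Qed.

Lemma sigma_sym s t : sigma s t -> sigma t s.
Proof. by move=> [u us ut]; exists u. Qed.

Lemma sigma_trans s t u : sigma s t -> sigma t u -> sigma s u.
Proof.
move=> [v vs [e ee vt]] [w [f ff wt] wu]; exists (e * f * t).
  by apply: nat_le_trans vs; exists f => //; rewrite vt mulgA (idemC ee ff).
by apply: nat_le_trans wu; exists e => //; rewrite wt mulgA.
Qed.

Lemma sigmaM s s' t t' : sigma s s' -> sigma t t' -> sigma (s * t) (s' * t').
Proof. by move=> [u us us'] [v vt vt']; exists (u * v); exact: nat_le_mul. Qed.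

Lemma sigmaV s t : sigma s t -> sigma s^* t^*.
Proof. by move=> [u us ut]; exists u^*; exact: nat_le_sinv. Qed.

Lemma sigma_idem e : idempotent_elt e -> sigma e 1.
Proof. by move=> ee; exists e; [exact: nat_le_refl|exists e; rewrite ?mulg1]. Qed.

Definition sigmab s t : bool := `[< sigma s t >].

Fact sigmab_equiv : equiv_class_of sigmab.
Proof.
split=> [s|s t|t s u]; first exact/asboolP/sigma_refl.
  by apply/asboolP/asboolP => /sigma_sym.
by move=> /asboolP st /asboolP tu; apply/asboolP/(sigma_trans st).
Qed.

Canonical sigma_equivRel := EquivRelPack sigmab_equiv.

Definition max_group_image : Type := {eq_quot sigma_equivRel}.

HB.instance Definition _ := Choice.on max_group_image.
HB.instance Definition _ := Quotient.on max_group_image.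

Definition sigma_class s : max_group_image := \pi_{eq_quot sigma_equivRel} s.

Local Notation G := max_group_image.

Lemma sigma_classP s t : sigma_class s = sigma_class t <-> sigma s t.
Proof. by split=> [/eqquotP/asboolP|h]; [|apply/eqquotP/asboolP]. Qed.

Lemma sigma_class_ind (P : G -> Prop) :
  (forall s, P (sigma_class s)) -> forall g, P g.
Proof. by move=> h g; rewrite -[g]reprK; apply: h. Qed.

Lemma sigma_repr s : sigma (repr (sigma_class s)) s.
Proof. by apply/sigma_classP; rewrite /sigma_class reprK. Qed.

Definition mgi_mul (g h : G) : G := sigma_class (repr g * repr h).
Definition mgi_inv (g : G) : G := sigma_class (repr g)^*.
Definition mgi_one : G := sigma_class 1.

Lemma mgi_mulE s t : mgi_mul (sigma_class s) (sigma_class t) = sigma_class (s * t).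
Proof. by apply/sigma_classP/sigmaM; exact: sigma_repr. Qed.

Lemma mgi_invE s : mgi_inv (sigma_class s) = sigma_class s^*.
Proof. by apply/sigma_classP/sigmaV; exact: sigma_repr. Qed.

Fact mgi_mulA : associative mgi_mul.
Proof.
elim/sigma_class_ind=> s; elim/sigma_class_ind=> t; elim/sigma_class_ind=> u.
by rewrite !mgi_mulE mulgA.
Qed.

Fact mgi_mul1 : left_id mgi_one mgi_mul.
Proof. by elim/sigma_class_ind=> s; rewrite mgi_mulE mul1g. Qed.

Fact mgi_1mul : right_id mgi_one mgi_mul.
Proof. by elim/sigma_class_ind=> s; rewrite mgi_mulE mulg1. Qed.

Fact mgi_mulV : left_inverse mgi_one mgi_inv mgi_mul.
Proof.
elim/sigma_class_ind=> s; rewrite mgi_invE mgi_mulE.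
exact/sigma_classP/sigma_idem/idem_mulVs.
Qed.

Fact mgi_Vmul : right_inverse mgi_one mgi_inv mgi_mul.
Proof.
elim/sigma_class_ind=> s; rewrite mgi_invE mgi_mulE.
exact/sigma_classP/sigma_idem/idem_mulsV.
Qed.

HB.instance Definition _ := isGroup.Build G
  mgi_mulA mgi_mul1 mgi_1mul mgi_mulV mgi_Vmul.

Lemma sigma_classM s t : sigma_class (s * t) = sigma_class s * sigma_class t.
Proof. by rewrite -mgi_mulE. Qed.

Lemma sigma_classV s : sigma_class s^* = (sigma_class s)^-1.
Proof. by rewrite -mgi_invE. Qed.

End InverseMonoidTheory.

(* A bijection between subsets of A, as its graph. *)
Record partial_bijection (A : Type) := PartialBijection {
  pgraph : A -> A -> Prop;
  pgraph_fun : forall x y y', pgraph x y -> pgraph x y' -> y = y';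
  pgraph_inj : forall x x' y, pgraph x y -> pgraph x' y -> x = x' }.

Section SymmetricInverseMonoid.
Variable A : Type.
Local Notation I := (partial_bijection A).
Implicit Types f g h : I.

Definition pdom f : set A := [set x | exists y, pgraph f x y].
Definition pran f : set A := [set y | exists x, pgraph f x y].

Lemma pb_ext f g : (forall x y, pgraph f x y <-> pgraph g x y) -> f = g.
Proof.
case: f g => [f f1 f2] [g g1 g2] /= h.
have E : f = g by apply/funext=> x; apply/funext=> y; exact/propext/h.
by case: g / E g1 g2 {h} => g1 g2; congr PartialBijection; exact: Prop_irrelevance.
Qed.

Definition pb_comp f g (x z : A) : Prop :=
  exists2 y, pgraph g x y & pgraph f y z.

Fact pb_comp_fun f g x y y' : pb_comp f g x y -> pb_comp f g x y' -> y = y'.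
Proof.
move=> [b gb fb] [c gc fc]; rewrite (pgraph_fun gb gc) in fb.
exact: pgraph_fun fb fc.
Qed.

Fact pb_comp_inj f g x x' y : pb_comp f g x y -> pb_comp f g x' y -> x = x'.
Proof.
move=> [b gb fb] [c gc fc]; rewrite (pgraph_inj fb fc) in gb.
exact: pgraph_inj gb gc.
Qed.

(* The product is composition, f after g, on the largest possible domain. *)
Definition pb_mul f g : I :=
  PartialBijection (@pb_comp_fun f g) (@pb_comp_inj f g).

Definition pb_one : I :=
  @PartialBijection A (fun x y => x = y)
    (fun x y y' xy xy' => etrans (esym xy) xy')
    (fun x x' y xy x'y => etrans xy (esym x'y)).

Definition pb_inv f : I :=
  {| pgraph := fun x y => pgraph f y x;
     pgraph_fun := fun x y y' => @pgraph_inj A f y y' x;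
     pgraph_inj := fun x x' y => @pgraph_fun A f y x x' |}.

HB.instance Definition _ := gen_eqMixin I.
HB.instance Definition _ := gen_choiceMixin I.

Fact pb_mulA : associative pb_mul.
Proof.
move=> f g h; apply: pb_ext => x y; split=> /=.
  by move=> [z [w hw gw] fz]; exists w => //; exists z.
by move=> [z hz [w gw fw]]; exists w => //; exists z.
Qed.

Fact pb_mul1 : left_id pb_one pb_mul.
Proof. by move=> f; apply: pb_ext => x y; split=> [[z fz <-]|fx] //; exists y. Qed.

Fact pb_1mul : right_id pb_one pb_mul.
Proof. by move=> f; apply: pb_ext => x y; split=> [[z -> fz]|fx] //; exists x. Qed.

HB.instance Definition _ := isMonoid.Build I pb_mulA pb_mul1 pb_1mul.

Fact pb_mulsVs f : (f * pb_inv f * f = f)%g.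
Proof.
apply: pb_ext => x y; split=> [[a fa [b /= fb fby]]|fx].
  by rewrite (pgraph_inj fa fb).
by exists y => //; exists x.
Qed.

Fact pb_mulVsV f : (pb_inv f * f * pb_inv f = pb_inv f)%g.
Proof.
apply: pb_ext => x y; split=> [[a /= fa [b fb fby]]|/= fx].
  by rewrite (pgraph_fun fa fb).
by exists y => //; exists x.
Qed.

Fact pb_inv_uniq f g : (f * g * f = f -> g * f * g = g -> g = pb_inv f)%g.
Proof.
move=> fgf gfg; apply: pb_ext => x y; split=> /= h.
  have := h; rewrite -{1}gfg => -[p gp [q fq gq]].
  by rewrite (pgraph_fun gp h) in fq; rewrite (pgraph_inj h gq).
have := h; rewrite -{1}fgf => -[p fp [q gq fq]].
by rewrite (pgraph_fun fp h) in gq; rewrite -(pgraph_inj fq h).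
Qed.

HB.instance Definition _ :=
  Monoid_isInverse.Build I pb_mulsVs pb_mulVsV pb_inv_uniq.

End SymmetricInverseMonoid.

(* The value at x, or 0 outside of the domain. *)
Definition papp (A : nmodType) (f : partial_bijection A) (x : A) : A :=
  xget 0 [set y | pgraph f x y].

Lemma pappE (A : nmodType) (f : partial_bijection A) x y :
  pgraph f x y -> papp f x = y.
Proof.
move=> fx; apply: (pgraph_fun _ fx).
exact: (xgetPex (P := [set y | pgraph f x y]) 0 (ex_intro _ y fx)).
Qed.

Lemma papp_dom (A : nmodType) (f : partial_bijection A) x :
  pdom f x -> pgraph f x (papp f x).
Proof. by case=> y fx; rewrite (pappE fx). Qed.

Section TwistedSum.
Variables (K : comPzRingType) (A : kalgType K) (M : monoidType).

Record twisting := Twisting {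
  tw_dom : M -> set A;
  tw_mul : M -> M -> A -> A -> A;
  tw_dom0 : forall g, tw_dom g 0;
  tw_domP : forall g k a b,
    tw_dom g a -> tw_dom g b -> tw_dom g (k *: a + b);
  tw_mul_dom : forall g h a b,
    tw_dom g a -> tw_dom h b -> tw_dom (g * h)%g (tw_mul g h a b);
  tw_mulPl : forall g h k a a' b, tw_dom g a -> tw_dom g a' -> tw_dom h b ->
    tw_mul g h (k *: a + a') b = k *: tw_mul g h a b + tw_mul g h a' b;
  tw_mulPr : forall g h k a b b', tw_dom g a -> tw_dom h b -> tw_dom h b' ->
    tw_mul g h a (k *: b + b') = k *: tw_mul g h a b + tw_mul g h a b';
  tw_mulA : forall g h l a b c, tw_dom g a -> tw_dom h b -> tw_dom l c ->
    tw_mul g (h * l)%g a (tw_mul h l b c) =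
    tw_mul (g * h)%g l (tw_mul g h a b) c;
  tw_one : tw_dom 1%g 1;
  tw_mul1 : forall g a, tw_dom g a -> tw_mul 1%g g 1 a = a;
  tw_1mul : forall g a, tw_dom g a -> tw_mul g 1%g a 1 = a }.

Variable T : twisting.
Local Notation D := (tw_dom T).
Local Notation mu := (tw_mul T).

Definition twisted_sum_pred : {pred M -> A} := fun x =>
  `[< finite_set [set g | x g != 0] /\ forall g, D g (x g) >].

(* The direct sum of the D g \delta_g, as finitely supported families, with   *)
(* (a \delta_g) (b \delta_h) = (mu g h a b) \delta_(gh).                      *)
Record twisted_sum := TwistedSum {
  tw_coef :> M -> A;
  _ : tw_coef \in twisted_sum_pred }.

HB.instance Definition _ := [isSub for tw_coef].
HB.instance Definition _ := [Choice of twisted_sum by <:].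

Definition dirac (g : M) (a : A) : M -> A := fun h => if h == g then a else 0.

Lemma twisted_sumP (x : twisted_sum) g : D g (x g).
Proof. by have /asboolP[_] := valP x. Qed.

Lemma tw_domD g a b : D g a -> D g b -> D g (a + b).
Proof. by move=> Da Db; rewrite -[a]scale1r; exact: tw_domP. Qed.

Lemma tw_domZ g k a : D g a -> D g (k *: a).
Proof. by move=> Da; rewrite -[_ *: _]addr0; apply/tw_domP/tw_dom0. Qed.

Fact twisted_sum_submod : submod_closed twisted_sum_pred.
Proof.
split=> [|k x y /asboolP[fx Dx] /asboolP[fy Dy]]; apply/asboolP.
  split=> [|g]; last exact: tw_dom0.
  apply: sub_finite_set (finite_set0 M) => g /=.
  by rewrite [X in X != _](_ : _ = 0) ?eqxx.
split=> [|g]; last exact: tw_domP.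
have : finite_set ([set g | x g != 0] `|` [set g | y g != 0]).
  by rewrite finite_setU.
apply: sub_finite_set => g /= xy0; apply/orP; apply: contraNT xy0.
rewrite negb_or !negbK => /andP[/eqP x0 /eqP y0].
by rewrite [X in X == _](_ : _ = k *: x g + y g) // x0 y0 scaler0 addr0.
Qed.

HB.instance Definition _ := GRing.SubChoice_isSubLmodule.Build
  K (M -> A) twisted_sum_pred twisted_sum
  (GRing.submod_closed_semi twisted_sum_submod).

Local Notation L := twisted_sum.
Implicit Types (x y z : L) (k : K).

Lemma tw_support (x : L) :
  exists2 r : seq M, uniq r & forall g, g \notin r -> x g = 0.
Proof.
have /asboolP[/finite_seqP[r rE] _] := valP x.
exists (undup r) => [|g]; first exact: undup_uniq.
rewrite mem_undup => gr; apply/eqP; apply: contraNT gr => xg.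
by have : [set g | x g != 0] g by []; rewrite rE.
Qed.

Lemma tw_support3 (x y z : L) : exists r : seq M,
  [/\ uniq r, forall g, g \notin r -> x g = 0, forall g, g \notin r -> y g = 0
    & forall g, g \notin r -> z g = 0].
Proof.
have [[rx _ hx] [ry _ hy] [rz _ hz]] :=
  And3 (tw_support x) (tw_support y) (tw_support z).
exists (undup (rx ++ ry ++ rz)); split; first exact: undup_uniq.
- by move=> g; rewrite mem_undup !mem_cat !negb_or => /and3P[? ? ?]; apply: hx.
- by move=> g; rewrite mem_undup !mem_cat !negb_or => /and3P[? ? ?]; apply: hy.
- by move=> g; rewrite mem_undup !mem_cat !negb_or => /and3P[? ? ?]; apply: hz.
Qed.

Lemma diracP g k a b : dirac g (k *: a + b) = k *: dirac g a + dirac g b.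
Proof.
apply/funext => h; rewrite [RHS](_ : _ = k *: dirac g a h + dirac g b h) //.
by rewrite /dirac; case: eqP; rewrite // scaler0 addr0.
Qed.

Lemma dirac0 g : dirac g 0 = 0.
Proof. by apply/funext => h; rewrite /dirac; case: eqP. Qed.

Lemma dirac_eq g a : dirac g a g = a.
Proof. by rewrite /dirac eqxx. Qed.

Lemma dirac_ne g h a : h != g -> dirac g a h = 0.
Proof. by rewrite /dirac => /negPf ->. Qed.

Fact dirac_pred g a : D g a -> dirac g a \in twisted_sum_pred.
Proof.
move=> Da; apply/asboolP; split=> [|h].
  apply: sub_finite_set (finite_set1 g) => h /=.
  by rewrite /dirac; have [->|_] := eqVneq h g; rewrite ?eqxx.
by rewrite /dirac; case: eqP => [->|_] //; exact: tw_dom0.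
Qed.

Definition delta g a (Da : D g a) : L := TwistedSum (dirac_pred Da).

Lemma tw_mul0l g h b : D h b -> mu g h 0 b = 0.
Proof.
move=> Db; have := tw_mulPl 1 (tw_dom0 T g) (tw_dom0 T g) Db.
by rewrite scaler0 addr0 scale1r => /eqP; rewrite -subr_eq subrr eq_sym => /eqP.
Qed.

Lemma tw_mul0r g h a : D g a -> mu g h a 0 = 0.
Proof.
move=> Da; have := tw_mulPr 1 Da (tw_dom0 T h) (tw_dom0 T h).
by rewrite scaler0 addr0 scale1r => /eqP; rewrite -subr_eq subrr eq_sym => /eqP.
Qed.

Definition tw_prod x y : M -> A :=
  \sum_(g \in [set: M]) \sum_(h \in [set: M])
    dirac (g * h)%g (mu g h (x g) (y h)).

Lemma tw_prodE (r : seq M) x y : uniq r ->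
    (forall g, g \notin r -> x g = 0) -> (forall g, g \notin r -> y g = 0) ->
  tw_prod x y =
  \sum_(g <- r) \sum_(h <- r) dirac (g * h)%g (mu g h (x g) (y h)).
Proof.
move=> ur hx hy.
have inner g : \sum_(h \in [set: M]) dirac (g * h)%g (mu g h (x g) (y h)) =
    \sum_(h <- r) dirac (g * h)%g (mu g h (x g) (y h)).
  rewrite (fsbigE r) //=; first by apply: eq_bigl => h; rewrite in_setT.
  move=> h _; have [//|/hy ->] := boolP (h \in r) => _.
  by rewrite tw_mul0r ?dirac0 //; exact: twisted_sumP.
transitivity (\sum_(g \in [set: M]) \sum_(h <- r)
    dirac (g * h)%g (mu g h (x g) (y h))).
  by apply: eq_fsbigr => g _; exact: inner.
rewrite (fsbigE r) //=; first by apply: eq_bigl => h; rewrite in_setT.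
move=> g _; have [//|/hx ->] := boolP (g \in r) => _.
by rewrite big1 // => h _; rewrite tw_mul0l ?dirac0 //; exact: twisted_sumP.
Qed.

Fact twisted_sum_predD f f' : f \in twisted_sum_pred -> f' \in twisted_sum_pred ->
  f + f' \in twisted_sum_pred.
Proof.
by have [_ h] := twisted_sum_submod => hf hf'; rewrite -[f]scale1r; exact: h.
Qed.

Fact tw_prod_pred x y : tw_prod x y \in twisted_sum_pred.
Proof.
have [r [ur hx hy _]] := tw_support3 x y x; rewrite (tw_prodE ur hx hy).
have [p0 _] := twisted_sum_submod.
elim/big_ind: _ => // [|g _]; first exact: twisted_sum_predD.
elim/big_ind: _ => // [|h _]; first exact: twisted_sum_predD.
by apply/dirac_pred/tw_mul_dom; exact: twisted_sumP.
Qed.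

Definition twisted_mul x y : L := TwistedSum (tw_prod_pred x y).
Definition twisted_one : L := delta (tw_one T).

Lemma twisted_mulPl k x y z :
  twisted_mul (k *: x + y) z = k *: twisted_mul x z + twisted_mul y z.
Proof.
have [r [ur hx hy hz]] := tw_support3 x y z.
have hxy g : g \notin r -> (k *: x + y) g = 0.
  move=> gr; rewrite [LHS](_ : _ = k *: x g + y g) //.
  by rewrite hx // hy // scaler0 addr0.
apply: val_inj; rewrite [RHS](_ : _ = k *: tw_prod x z + tw_prod y z) //.
rewrite [LHS](_ : _ = tw_prod (k *: x + y) z) //.
rewrite (tw_prodE ur hxy hz) (tw_prodE ur hx hz) (tw_prodE ur hy hz).
rewrite scaler_sumr -big_split; apply: eq_bigr => g _ /=.
rewrite scaler_sumr -big_split; apply: eq_bigr => h _ /=.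
by rewrite -diracP -tw_mulPl //; exact: twisted_sumP.
Qed.

Lemma twisted_mulPr k x y z :
  twisted_mul x (k *: y + z) = k *: twisted_mul x y + twisted_mul x z.
Proof.
have [r [ur hx hy hz]] := tw_support3 x y z.
have hyz g : g \notin r -> (k *: y + z) g = 0.
  move=> gr; rewrite [LHS](_ : _ = k *: y g + z g) //.
  by rewrite hy // hz // scaler0 addr0.
apply: val_inj; rewrite [RHS](_ : _ = k *: tw_prod x y + tw_prod x z) //.
rewrite [LHS](_ : _ = tw_prod x (k *: y + z)) //.
rewrite (tw_prodE ur hx hyz) (tw_prodE ur hx hz) (tw_prodE ur hx hy).
rewrite scaler_sumr -big_split; apply: eq_bigr => g _ /=.
rewrite scaler_sumr -big_split; apply: eq_bigr => h _ /=.
by rewrite -diracP -tw_mulPr //; exact: twisted_sumP.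
Qed.

Fact twisted_mulDl : left_distributive twisted_mul +%R.
Proof. by move=> x y z; have := twisted_mulPl 1 x y z; rewrite !scale1r. Qed.

Fact twisted_mulDr : right_distributive twisted_mul +%R.
Proof. by move=> x y z; have := twisted_mulPr 1 x y z; rewrite !scale1r. Qed.

Lemma twisted_mul0l x : twisted_mul 0 x = 0.
Proof.
have := twisted_mulDl 0 0 x; rewrite addr0 => /eqP.
by rewrite -subr_eq subrr eq_sym => /eqP.
Qed.

Lemma twisted_mul0r x : twisted_mul x 0 = 0.
Proof.
have := twisted_mulDr x 0 0; rewrite addr0 => /eqP.
by rewrite -subr_eq subrr eq_sym => /eqP.
Qed.

Fact twisted_scaleAl k x y : k *: twisted_mul x y = twisted_mul (k *: x) y.
Proof.
by have := twisted_mulPl k x 0 y; rewrite twisted_mul0l !addr0 => ->.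
Qed.

Fact twisted_scaleAr k x y : k *: twisted_mul x y = twisted_mul x (k *: y).
Proof.
by have := twisted_mulPr k x y 0; rewrite twisted_mul0r !addr0 => ->.
Qed.

Lemma tw_coef_sum (I : Type) (r : seq I) (F : I -> L) g :
  (\sum_(i <- r) F i) g = \sum_(i <- r) F i g.
Proof. by elim/big_rec2: _ => //= i a b _ <-. Qed.

Lemma twisted_sum_ind (P : L -> Prop) :
    P 0 -> (forall x y, P x -> P y -> P (x + y)) ->
    (forall g a (Da : D g a), P (delta Da)) ->
  forall x, P x.
Proof.
move=> P0 PD Pd x; have [r ur hx] := tw_support x.
have -> : x = \sum_(g <- r) delta (twisted_sumP x g).
  apply: val_inj; apply/funext => h /=; rewrite tw_coef_sum /= /dirac.
  have [hr|/hx x0] := boolP (h \in r).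
    rewrite (bigD1_seq h) //= eqxx big1 ?addr0 // => g /negPf gh.
    by rewrite eq_sym gh.
  by rewrite x0 big1 // => g _; case: eqP => [<-|].
by elim/big_ind: _.
Qed.

Lemma twisted_mul_delta g h a b (Da : D g a) (Db : D h b) :
  twisted_mul (delta Da) (delta Db) = delta (tw_mul_dom Da Db).
Proof.
have [r [ur gr hr]] : exists r : seq M, [/\ uniq r, g \in r & h \in r].
  exists (undup [:: g; h]); split; first exact: undup_uniq.
    by rewrite mem_undup inE eqxx.
  by rewrite mem_undup !inE eqxx orbT.
apply: val_inj => /=; rewrite (@tw_prodE r) //=; first last.
- by move=> l lr; apply: dirac_ne; apply: contraNneq lr => ->.
- by move=> l lr; apply: dirac_ne; apply: contraNneq lr => ->.
rewrite (bigD1_seq g) //= (bigD1_seq h) //=.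
rewrite !dirac_eq big1 => [|l lh].
  rewrite addr0 big1 ?addr0 // => l lg; rewrite big1 // => l' _.
  by rewrite dirac_ne // tw_mul0l ?dirac0 //; exact: (twisted_sumP (delta Db)).
by rewrite dirac_ne // tw_mul0r ?dirac0.
Qed.

Fact twisted_mulA : associative twisted_mul.
Proof.
move=> x y z; elim/twisted_sum_ind: x => [|x x' IH IH'|g a Da].
- by rewrite !twisted_mul0l.
- by rewrite !twisted_mulDl IH IH'.
elim/twisted_sum_ind: y => [|y y' IH IH'|h b Db].
- by rewrite !(twisted_mul0l, twisted_mul0r).
- by rewrite !(twisted_mulDr, twisted_mulDl) IH IH'.
elim/twisted_sum_ind: z => [|z z' IH IH'|l c Dc].
- by rewrite !twisted_mul0r.
- by rewrite !twisted_mulDr IH IH'.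
rewrite !twisted_mul_delta; apply: val_inj => /=.
by rewrite mulgA tw_mulA.
Qed.

Fact twisted_mul1 : left_id twisted_one twisted_mul.
Proof.
elim/twisted_sum_ind => [|x x' IH IH'|g a Da]; first by rewrite twisted_mul0r.
  by rewrite twisted_mulDr IH IH'.
by rewrite twisted_mul_delta; apply: val_inj; rewrite /= mul1g tw_mul1.
Qed.

Fact twisted_1mul : right_id twisted_one twisted_mul.
Proof.
elim/twisted_sum_ind => [|x x' IH IH'|g a Da]; first by rewrite twisted_mul0l.
  by rewrite twisted_mulDl IH IH'.
by rewrite twisted_mul_delta; apply: val_inj; rewrite /= mulg1 tw_1mul.
Qed.

HB.instance Definition _ := GRing.Zmodule_isPzRing.Build twisted_sum
  twisted_mulA twisted_mul1 twisted_1mul twisted_mulDl twisted_mulDr.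

HB.instance Definition _ := PzRing_isKAlgebra.Build K twisted_sum
  (@scalerA K twisted_sum) (@scale1r K twisted_sum) (@scalerDr K twisted_sum)
  (@scalerDl K twisted_sum) twisted_scaleAl twisted_scaleAr.

End TwistedSum.

Section UnitalAction.
Variables (S : inverseMonoidType) (K : comPzRingType) (A : kalgType K).

Record unital_action := UnitalAction {
  act :> S -> partial_bijection A;
  actM : forall s t, act (s * t)%g = (act s * act t)%g;
  act1 : act 1%g = 1%g;
  act_pdom_ideal : forall s, two_sided_ideal (pdom (act s));
  act_pran_ideal : forall s, two_sided_ideal (pran (act s));
  actD : forall s,
    {in pdom (act s) &, {morph papp (act s) : x y / x + y >-> x + y}};
  act_mul : forall s,
    {in pdom (act s) &, {morph papp (act s) : x y / x * y >-> x * y}};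
  actZ : forall s k,
    {in pdom (act s), {morph papp (act s) : x / k *: x >-> k *: x}};
  act_unital : forall s,
    exists e : A, central_idempotent e /\ pran (act s) = range ( *%R e) }.

Definition compatible (theta : unital_action) : Prop :=
  forall s t, sigma s t -> forall x,
    pdom (theta s) x -> pdom (theta t) x -> papp (theta s) x = papp (theta t) x.

Variable theta : unital_action.

(* The central idempotent 1_s; it is unique. *)
Definition act_idem (s : S) : A :=
  xget 0 [set e | central_idempotent e /\ pran (theta s) = range ( *%R e)].

Local Notation "1_[ s ]" := (act_idem s) (format "1_[ s ]").
Implicit Types (s t u : S) (x y z a b c : A) (k : K).

Lemma act_idemP s :
  central_idempotent 1_[s] /\ pran (theta s) = range ( *%R 1_[s]).
Proof.
exact: (xgetPex (P := [set e | central_idempotent e /\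
  pran (theta s) = range ( *%R e)]) 0 (act_unital theta s)).
Qed.

Lemma act_idem_unique s e :
  central_idempotent e -> pran (theta s) = range ( *%R e) -> e = 1_[s].
Proof.
have [[ii iC] ri] := act_idemP s; move=> [ee eC] re.
have [a _ ea] : range ( *%R 1_[s]) e by rewrite -ri re; exists 1; rewrite ?mulr1.
have [b _ ib] : range ( *%R e) 1_[s] by rewrite -re ri; exists 1; rewrite ?mulr1.
have <- : 1_[s] * e = e by rewrite -ea mulrA ii.
by rewrite iC -{1}ib mulrA ee ib.
Qed.

Lemma idemK s : 1_[s] * 1_[s] = 1_[s].
Proof. by have [[]] := act_idemP s. Qed.

Lemma act_idemC s x : 1_[s] * x = x * 1_[s].
Proof. by have [[_ ->]] := act_idemP s. Qed.

Lemma idemKl s x : 1_[s] * (1_[s] * x) = 1_[s] * x.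
Proof. by rewrite mulrA idemK. Qed.

Lemma idemCA s x y : 1_[s] * (x * y) = x * (1_[s] * y).
Proof. by rewrite mulrA act_idemC mulrA. Qed.

Lemma pranP s x : pran (theta s) x <-> 1_[s] * x = x.
Proof.
have [_ ->] := act_idemP s; split=> [[y _ <-]|h]; first exact: idemKl.
by exists x.
Qed.

Lemma act_sinv s : theta s^*%g = (theta s)^*%g.
Proof. by apply: sinv_uniq; rewrite -!actM (mulsVs, mulVsV). Qed.

Lemma pdomP s x : pdom (theta s) x <-> 1_[s^*%g] * x = x.
Proof. by rewrite -pranP act_sinv. Qed.

Lemma pdom_idem s x : pdom (theta s) (1_[s^*%g] * x).
Proof. by apply/pdomP; exact: idemKl. Qed.

(* act_ext s x = theta_s (1_(s^-1) x). *)
Definition act_ext s x : A := papp (theta s) (1_[s^*%g] * x).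
Local Notation "'al'" := act_ext.

Lemma pgraphP s x y : pgraph (theta s) x y <-> 1_[s^*%g] * x = x /\ y = al s x.
Proof.
split=> [h|[h ->]].
  have hx : 1_[s^*%g] * x = x by apply/pdomP; exists y.
  by split=> //; rewrite /act_ext hx (pappE h).
by rewrite /act_ext h; exact/papp_dom/pdomP.
Qed.

Lemma pappP s x : 1_[s^*%g] * x = x -> papp (theta s) x = al s x.
Proof. by rewrite /act_ext => ->. Qed.

Lemma al_idemr s x : al s (1_[s^*%g] * x) = al s x.
Proof. by rewrite /act_ext idemKl. Qed.

Lemma al_idem s x : 1_[s] * al s x = al s x.
Proof.
apply/pranP; exists (1_[s^*%g] * x); apply/pgraphP; split; first exact: idemKl.
by rewrite al_idemr.
Qed.

Lemma in_pdom_idem s x : 1_[s^*%g] * x \in pdom (theta s).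
Proof. by rewrite inE; exact: pdom_idem. Qed.

Lemma alD s x y : al s (x + y) = al s x + al s y.
Proof. by rewrite /act_ext mulrDr actD ?in_pdom_idem. Qed.

Lemma alZ s k x : al s (k *: x) = k *: al s x.
Proof. by rewrite /act_ext -kscalerAr actZ ?in_pdom_idem. Qed.

Lemma alM s x y : al s (x * y) = al s x * al s y.
Proof.
rewrite /act_ext -act_mul ?in_pdom_idem //; congr papp.
by rewrite -mulrA -(idemCA _ x y) idemKl.
Qed.

Lemma alK s x : al s^*%g (al s x) = 1_[s^*%g] * x.
Proof.
have : pgraph (theta s^*%g) (al s x) (1_[s^*%g] * x).
  rewrite act_sinv /=; apply/pgraphP; split; first exact: idemKl.
  by rewrite al_idemr.
by move/pgraphP => [].
Qed.

Lemma alVK s x : al s (al s^*%g x) = 1_[s] * x.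
Proof. by have := alK s^*%g x; rewrite sinvK. Qed.

Lemma al1 s : al s 1 = 1_[s].
Proof. by rewrite -[LHS]al_idem -{1}[1_[s]](mulr1 _) -alVK -alM mulr1 alVK mulr1. Qed.

Lemma al_idemV s : al s 1_[s^*%g] = 1_[s].
Proof. by rewrite -[1_[s^*%g]]mulr1 al_idemr al1. Qed.

Lemma alA s t x : al s (al t x) = al (s * t)%g x.
Proof.
have domst w : 1_[(s * t)^*%g] * w = w <->
    1_[t^*%g] * w = w /\ 1_[s^*%g] * al t w = al t w.
  rewrite -pdomP actM; split=> [[y [z /pgraphP[h1 ->] /pgraphP[h2 _]]]|[h1 h2]] //.
  by exists (al s (al t w)); exists (al t w); apply/pgraphP.
have alst w : 1_[(s * t)^*%g] * w = w -> al (s * t)%g w = al s (al t w).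
  move=> hw; have [h1 h2] := (domst w).1 hw.
  have : pgraph (theta (s * t)%g) w (al s (al t w)).
    by rewrite actM; exists (al t w); apply/pgraphP.
  by move/pgraphP => [_ ->].
rewrite -[RHS]al_idemr alst ?idemKl // !alM.
set w := al t^*%g (1_[s^*%g] * al t x).
have tw : al t w = 1_[s^*%g] * al t x by rewrite alVK idemCA al_idem.
have hw : 1_[(s * t)^*%g] * w = w.
  by apply: (domst w).2; split; [exact: al_idem|rewrite tw idemKl].
have -> : al s (al t x) = al s (al t w) by rewrite tw al_idemr.
by rewrite -!alM hw.
Qed.

Lemma al1g x : al 1%g x = x.
Proof.
have : pgraph (theta 1%g) x x by rewrite act1.
by move/pgraphP => [].
Qed.

Lemma act_idem1 : 1_[1%g] = 1.
Proof. by rewrite -al1 al1g. Qed.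

Lemma al0 s : al s 0 = 0.
Proof. by have := alZ s 0 0; rewrite !scale0r. Qed.

Lemma al_dom s t a b : 1_[s] * a = a -> 1_[t] * b = b ->
  1_[(s * t)%g] * (a * al s b) = a * al s b.
Proof.
move=> ha hb; rewrite idemCA; congr (_ * _).
by rewrite -(al1 (s * t)%g) -alA al1 -alM hb.
Qed.

Definition crossed_dom s : set A := range ( *%R 1_[s]).
Definition crossed_mul s t a b : A := a * papp (theta s) (1_[s^*%g] * b).

Lemma crossed_domP s a : crossed_dom s a <-> 1_[s] * a = a.
Proof. by split=> [[x _ <-]|<-]; [exact: idemKl|exists a]. Qed.

Fact crossed_dom0 s : crossed_dom s 0.
Proof. by apply/crossed_domP; rewrite mulr0. Qed.

Fact crossed_dom_lin s k a b :
  crossed_dom s a -> crossed_dom s b -> crossed_dom s (k *: a + b).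
Proof.
move=> /crossed_domP ha /crossed_domP hb; apply/crossed_domP.
by rewrite mulrDr -kscalerAr ha hb.
Qed.

Fact crossed_mul_dom s t a b :
  crossed_dom s a -> crossed_dom t b -> crossed_dom (s * t)%g (crossed_mul s t a b).
Proof.
move=> /crossed_domP ha /crossed_domP hb; apply/crossed_domP.
exact: al_dom ha hb.
Qed.

Fact crossed_mulPl s t k a a' b :
  crossed_dom s a -> crossed_dom s a' -> crossed_dom t b ->
  crossed_mul s t (k *: a + a') b =
  k *: crossed_mul s t a b + crossed_mul s t a' b.
Proof. by rewrite /crossed_mul mulrDl -kscalerAl. Qed.

Fact crossed_mulPr s t k a b b' :
  crossed_dom s a -> crossed_dom t b -> crossed_dom t b' ->
  crossed_mul s t a (k *: b + b') =
  k *: crossed_mul s t a b + crossed_mul s t a b'.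
Proof.
move=> _ _ _; rewrite /crossed_mul -/(al s _) alD alZ mulrDr -kscalerAr.
by [].
Qed.

Fact crossed_mulA s t u a b c :
  crossed_dom s a -> crossed_dom t b -> crossed_dom u c ->
  crossed_mul s (t * u)%g a (crossed_mul t u b c) =
  crossed_mul (s * t)%g u (crossed_mul s t a b) c.
Proof.
by move=> _ _ _; rewrite /crossed_mul -!/(al _ _) alM alA mulrA.
Qed.

Fact crossed_one : crossed_dom 1%g 1.
Proof. by apply/crossed_domP; rewrite act_idem1 mulr1. Qed.

Fact crossed_mul1 s a : crossed_dom s a -> crossed_mul 1%g s 1 a = a.
Proof. by rewrite /crossed_mul -/(al _ _) al1g mul1r. Qed.

Fact crossed_1mul s a : crossed_dom s a -> crossed_mul s 1%g a 1 = a.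
Proof.
by move=> /crossed_domP ha; rewrite /crossed_mul -/(al _ _) al1 -act_idemC.
Qed.

Definition crossed_twisting : twisting A S :=
  Twisting crossed_dom0 crossed_dom_lin crossed_mul_dom crossed_mulPl
    crossed_mulPr crossed_mulA crossed_one crossed_mul1 crossed_1mul.

(* L(A, theta, S) *)
Definition crossed_sum : kalgType K := twisted_sum crossed_twisting.

(* The a \delta_s - a \delta_t with s <= t and a in 1_s A. *)
Definition crossed_relators : set crossed_sum :=
  [set x : twisted_sum crossed_twisting | exists s t a,
     [/\ nat_le s t, range ( *%R 1_[s]) a
       & x = dirac s a - dirac t a :> (S -> A)]].

Definition crossed_product : kalgType K := quotient_algebra crossed_relators.

(* A finite family of pairs (s, a) with s in g and a in 1_(s^-1) A. *)
Definition induced_family (g : max_group_image S) (l : seq (S * A)) : Prop :=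
  forall p, p \in l ->
    sigma_class p.1 = g /\ range ( *%R 1_[p.1^*%g]) p.2.

Definition induced_graph (g : max_group_image S) x y : Prop :=
  exists l : seq (S * A), [/\ induced_family g l, x = \sum_(p <- l) p.2
    & y = \sum_(p <- l) papp (theta p.1) p.2].

Definition induced_dom (g : max_group_image S) : set A :=
  [set x | exists2 l : seq (S * A),
     forall p, p \in l -> sigma_class p.1 = g /\ range ( *%R 1_[p.1]) p.2
   & x = \sum_(p <- l) p.2].

Lemma induced_familyP g l : induced_family g l <->
  forall p, p \in l -> sigma_class p.1 = g /\ 1_[p.1^*%g] * p.2 = p.2.
Proof.
by split=> h p /h [h1 h2]; split=> //; apply/crossed_domP; exact: h2.
Qed.

Lemma induced_familyE g l : induced_family g l ->
  \sum_(p <- l) papp (theta p.1) p.2 = \sum_(p <- l) al p.1 p.2.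
Proof.
move=> /induced_familyP h; rewrite !big_seq; apply: eq_bigr => p /h [_ pE].
exact: pappP.
Qed.

Lemma idem_join (l : seq S) : exists u : A,
  (forall y, (forall s, s \in l -> 1_[s] * y = 0) -> u * y = 0) /\
  (forall s, s \in l -> u * 1_[s] = 1_[s]).
Proof.
elim: l => [|s l [u [u0 u1]]]; first by exists 0; split=> // y _; rewrite mul0r.
exists (u + 1_[s] - u * 1_[s]); split=> [y hy|t].
  have sy : 1_[s] * y = 0 by apply: hy; rewrite inE eqxx.
  have uy : u * y = 0 by apply: u0 => t tl; apply: hy; rewrite inE tl orbT.
  by rewrite mulrBl mulrDl -mulrA sy uy mulr0 subr0 addr0.
rewrite inE => /orP[/eqP ->|/u1 ut].
  by rewrite mulrBl mulrDl -mulrA idemK addrAC subrr add0r.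
by rewrite mulrBl mulrDl ut -act_idemC -mulrA ut addrK.
Qed.

Lemma E_unitary_compatible : E_unitary S -> compatible theta.
Proof.
move=> ES; have idem s t : sigma s t -> idempotent_elt (s * t^*)%g.
  move=> [u us ut]; apply: (ES (u * u^*)%g); first exact: idem_mulsV.
  exact: nat_le_mul (nat_le_sinv ut).
have al_idem_elt e x : idempotent_elt e -> al e x = 1_[e] * x.
  by move=> ee; have := alK e x; rewrite (sinv_idem ee) alA ee.
have step s t x : sigma s t -> 1_[t^*%g] * x = x ->
    al s x = 1_[(s * t^*)%g] * al t x.
  by move=> st tx; rewrite -(al_idem_elt _ _ (idem _ _ st)) -alA alK tx.
move=> s t st x /pdomP sx /pdomP tx; rewrite !pappP //.
have E : (t * s^*)%g = (s * t^*)%g.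
  by rewrite -[RHS](sinv_idem (idem _ _ st)) sinvM sinvK.
rewrite [LHS](step s t x st tx) [RHS](step t s x (sigma_sym st) sx) E.
by rewrite (step s t x st tx) idemKl.
Qed.

Hypothesis theta_compat : compatible theta.

Lemma compat_al s t x : sigma s t ->
  1_[s^*%g] * x = x -> 1_[t^*%g] * x = x -> al s x = al t x.
Proof.
move=> st hs ht; rewrite -(pappP hs) -(pappP ht).
by apply: theta_compat => //; apply/pdomP.
Qed.

Lemma compat_idem s t : sigma s t -> al s^*%g 1_[t] = 1_[s^*%g] * 1_[t^*%g].
Proof.
have half s' t' : sigma s' t' ->
    1_[s'] * 1_[t'] * al s' 1_[t'^*%g] = al s' 1_[t'^*%g].
  move=> st'; have E : al s' 1_[t'^*%g] = al t' (1_[s'^*%g] * 1_[t'^*%g]).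
    rewrite -al_idemr; apply: compat_al => //; first exact: idemKl.
    by rewrite idemCA idemK.
  by rewrite -mulrA E al_idem -E al_idem.
move=> st; set w := al s^*%g _; set u := _ * _; pose v := al s 1_[t^*%g].
have hw : u * w = w by have := half _ _ (sigmaV st); rewrite !sinvK.
have hv : 1_[t] * v = v by have := half _ _ st; rewrite -/v => <-; rewrite -!mulrA idemCA idemKl.
have vu : al s^*%g v = u by rewrite alK.
have wu : w * u = u by rewrite -vu -alM hv.
rewrite -hw -[RHS]wu -[u * w]mulrA (act_idemC t^*%g w) mulrA.
by rewrite (act_idemC s^*%g w) mulrA.
Qed.

Lemma compat_alK s t a : sigma s t -> 1_[s^*%g] * a = a ->
  al t^*%g (al s a) = 1_[t^*%g] * a.
Proof.
move=> st ha; rewrite -al_idemr sinvK.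
rewrite -(compat_al (s := s^*%g)) ?sinvK; first last.
- exact: idemKl.
- by rewrite idemCA al_idem.
- exact: sigmaV.
by rewrite alM alK ha (compat_idem st) act_idemC -mulrA ha.
Qed.

Lemma induced_family_sigma g l p q : induced_family g l ->
  p \in l -> q \in l -> sigma p.1 q.1.
Proof. by move=> h /h [pg _] /h [qg _]; apply/sigma_classP; rewrite pg qg. Qed.

Lemma induced0 g l : induced_family g l ->
  \sum_(p <- l) p.2 = 0 -> \sum_(p <- l) al p.1 p.2 = 0.
Proof.
move=> hl l0; set y := (X in X = _); have [u [u0 u1]] := idem_join (map fst l).
have {u0}uy : u * y = 0.
  apply: u0 => _ /mapP[q ql ->]; rewrite -alVK.
  suff -> : al q.1^*%g y = 0 by exact: al0.
  have -> : al q.1^*%g y = \sum_(p <- l) al q.1^*%g (al p.1 p.2).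
    by rewrite /y; elim/big_rec2: _ => [|p a b _ <-]; rewrite ?al0 ?alD.
  transitivity (1_[q.1^*%g] * \sum_(p <- l) p.2); last by rewrite l0 mulr0.
  rewrite mulr_sumr !big_seq.
  apply: eq_bigr => p pl; apply: compat_alK.
    exact: induced_family_sigma hl pl ql.
  by have [_] := (induced_familyP g l).1 hl p pl.
rewrite -uy /y mulr_sumr !big_seq; apply: eq_bigr => p pl.
by rewrite -al_idem mulrA u1 //; apply: map_f.
Qed.

Lemma induced_family_cat g l l' :
  induced_family g l -> induced_family g l' -> induced_family g (l ++ l').
Proof. by move=> h h' p; rewrite mem_cat => /orP[/h|/h']. Qed.

Lemma induced_family_scale g k l : induced_family g l ->
  induced_family g [seq (p.1, k *: p.2) | p <- l].
Proof.
move=> h _ /mapP[p /h [pg /crossed_domP pE] ->]; split=> //.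
by apply/crossed_domP; rewrite /= -kscalerAr pE.
Qed.

Lemma induced_graph_lin g k x x' y y' :
  induced_graph g x y -> induced_graph g x' y' ->
  induced_graph g (k *: x + x') (k *: y + y').
Proof.
move=> [l [hl -> ->]] [l' [hl' -> ->]].
have hkl := induced_family_scale (k := k) hl.
exists ([seq (p.1, k *: p.2) | p <- l] ++ l'); split.
- exact: induced_family_cat.
- by rewrite big_cat big_map scaler_sumr.
rewrite big_cat (induced_familyE hkl) (induced_familyE hl) big_map scaler_sumr.
by congr (_ + _); apply: eq_bigr => p _; rewrite alZ.
Qed.

Fact induced_graph_fun g x y y' :
  induced_graph g x y -> induced_graph g x y' -> y = y'.
Proof.
move=> h /(induced_graph_lin (-1)) h'; have [l [hl l0 yE]] := h' _ _ h.
rewrite scaleN1r addNr in l0; rewrite (induced_familyE hl) in yE.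
move: yE; rewrite (induced0 hl (esym l0)) scaleN1r addrC => /eqP.
by rewrite subr_eq0 => /eqP.
Qed.

Lemma induced_graph_sym g x y : induced_graph g x y -> induced_graph g^-1%g y x.
Proof.
move=> [l [hl -> ->]]; exists [seq (p.1^*%g, al p.1 p.2) | p <- l].
have hl' : induced_family g^-1%g [seq (p.1^*%g, al p.1 p.2) | p <- l].
  move=> _ /mapP[p /hl [pg _] ->]; split; first by rewrite sigma_classV pg.
  by apply/crossed_domP; rewrite /= sinvK al_idem.
split=> //; first by rewrite big_map (induced_familyE hl).
rewrite (induced_familyE hl') big_map !big_seq; apply: eq_bigr => p pl.
by rewrite alK; have [_ ->] := (induced_familyP g l).1 hl p pl.
Qed.

Fact induced_graph_inj g x x' y :
  induced_graph g x y -> induced_graph g x' y -> x = x'.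
Proof.
by move=> /induced_graph_sym h /induced_graph_sym; exact: induced_graph_fun.
Qed.

Definition induced_action (g : max_group_image S) : partial_bijection A :=
  PartialBijection (@induced_graph_fun g) (@induced_graph_inj g).

Local Notation th := induced_action.

Lemma induced_actionE g l : induced_family g l ->
  papp (th g) (\sum_(p <- l) p.2) = \sum_(p <- l) papp (theta p.1) p.2.
Proof. by move=> hl; apply: pappE; exists l. Qed.

Definition skew_mul (g h : max_group_image S) a b : A :=
  papp (th g) (papp (th g)^*%g a * b).

Lemma induced_graph1 s x : 1_[s^*%g] * x = x ->
  induced_graph (sigma_class s) x (al s x).
Proof.
move=> hx; exists [:: (s, x)]; rewrite !big_seq1 /= pappP //; split=> // p.
by rewrite inE => /eqP ->; split=> //; apply/crossed_domP.
Qed.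

Lemma induced_graph0 g : induced_graph g 0 0.
Proof. by exists [::]; rewrite !big_nil. Qed.

Lemma induced_domP g x : induced_dom g x <-> exists y, induced_graph g y x.
Proof.
split=> [[l hl ->]|[y [l [hl _ ->]]]].
  suff [y hy] : exists y, induced_graph g^-1%g (\sum_(p <- l) p.2) y.
    by exists y; have := induced_graph_sym hy; rewrite invgK.
  exists (\sum_(p <- l) al p.1^*%g p.2).
  have hl' : induced_family g^-1%g [seq (p.1^*%g, p.2) | p <- l].
    move=> _ /mapP[p /hl [pg pE] ->]; split; first by rewrite sigma_classV pg.
    by rewrite /= sinvK.
  exists [seq (p.1^*%g, p.2) | p <- l]; split=> //; first by rewrite big_map.
  by rewrite (induced_familyE hl') big_map.
exists [seq (p.1, al p.1 p.2) | p <- l]; last first.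
  by rewrite (induced_familyE hl) big_map.
move=> _ /mapP[p /hl [pg pE] ->]; split=> //.
by apply/crossed_domP; rewrite /= al_idem.
Qed.

Lemma induced_action_pran g : pran (th g) = induced_dom g.
Proof. by apply/funext => x; apply/propext; rewrite induced_domP. Qed.

Lemma induced_action_pdom g : pdom (th g) = induced_dom g^-1%g.
Proof.
apply/funext => x; apply/propext; rewrite induced_domP.
split=> -[y h]; exists y; first exact: induced_graph_sym.
by rewrite -[g]invgK; exact: induced_graph_sym.
Qed.

Lemma induced_dom_ind g (P : A -> Prop) :
    P 0 -> (forall x y, induced_dom g x -> induced_dom g y -> P x -> P y -> P (x + y)) ->
    (forall s x, sigma_class s = g -> 1_[s] * x = x -> P x) ->
  forall x, induced_dom g x -> P x.
Proof.
move=> P0 PD Ps _ [l hl ->].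
suff [] : induced_dom g (\sum_(p <- l) p.2) /\ P (\sum_(p <- l) p.2) by [].
elim: l hl => [|p l IH] hl.
  by rewrite big_nil; split=> //; exists [::]; rewrite ?big_nil.
have [pg pE] := hl p (mem_head _ _).
have {IH}[Dl Pl] : induced_dom g (\sum_(p <- l) p.2) /\ P (\sum_(p <- l) p.2).
  by apply: IH => q ql; apply: hl; rewrite inE ql orbT.
have Dp : induced_dom g p.2.
  by exists [:: p]; rewrite ?big_seq1 // => q; rewrite inE => /eqP ->.
split; first by exists (p :: l).
rewrite big_cons; apply: PD => //.
by apply: (Ps p.1) => //; apply/crossed_domP.
Qed.

Fact induced_dom0 g : induced_dom g 0.
Proof. by apply/induced_domP; exists 0; exact: induced_graph0. Qed.

Fact induced_dom_lin g k a b :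
  induced_dom g a -> induced_dom g b -> induced_dom g (k *: a + b).
Proof.
move=> /induced_domP[x hx] /induced_domP[y hy]; apply/induced_domP.
by exists (k *: x + y); exact: induced_graph_lin.
Qed.

Lemma induced_domD g a b :
  induced_dom g a -> induced_dom g b -> induced_dom g (a + b).
Proof. by move=> ha hb; rewrite -[a]scale1r; exact: induced_dom_lin. Qed.

Lemma induced_dom1 s x : 1_[s] * x = x -> induced_dom (sigma_class s) x.
Proof.
move=> hx; exists [:: (s, x)]; rewrite ?big_seq1 // => p.
by rewrite inE => /eqP ->; split=> //; apply/crossed_domP.
Qed.

Lemma induced_domMr g a b : induced_dom g a -> induced_dom g (a * b).
Proof.
move: a; apply: induced_dom_ind => [|x y _ _ hx hy|s x <- hx].
- by rewrite mul0r; exact: induced_dom0.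
- by rewrite mulrDl; exact: induced_domD.
by apply: induced_dom1; rewrite mulrA hx.
Qed.

Lemma papp_induced_lin g k x y :
  induced_dom g^-1%g x -> induced_dom g^-1%g y ->
  papp (th g) (k *: x + y) = k *: papp (th g) x + papp (th g) y.
Proof.
rewrite -!induced_action_pdom => hx hy; apply: pappE; apply: induced_graph_lin.
  exact: papp_dom hx.
exact: papp_dom hy.
Qed.

Lemma induced_inv_graph g a : induced_dom g a ->
  induced_graph g (papp (th g)^*%g a) a.
Proof. by rewrite -induced_action_pran => h; exact: (papp_dom (f := (th g)^*%g) h). Qed.

Lemma papp_induced_inv_lin g k x y :
  induced_dom g x -> induced_dom g y ->
  papp (th g)^*%g (k *: x + y) = k *: papp (th g)^*%g x + papp (th g)^*%g y.
Proof.
move=> hx hy; apply: pappE; apply: induced_graph_lin; exact: induced_inv_graph.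
Qed.

Lemma induced_inv_dom g a : induced_dom g a ->
  induced_dom g^-1%g (papp (th g)^*%g a).
Proof.
by move=> ha; rewrite -induced_action_pdom; exists a; exact: induced_inv_graph.
Qed.

Lemma skew_mulE s g h a b : sigma_class s = g -> 1_[s] * a = a ->
  skew_mul g h a b = a * al s b.
Proof.
move=> <- ha; rewrite /skew_mul.
have -> : papp (th (sigma_class s))^*%g a = al s^*%g a.
  have hs : 1_[s^*%g] * al s^*%g a = al s^*%g a by exact: al_idem.
  by apply: pappE; have := induced_graph1 hs; rewrite alVK ha.
apply: pappE; rewrite -{2}ha -(alVK s a) -alM; apply: induced_graph1.
by rewrite mulrA al_idem.
Qed.

Fact skew_mulPl g h k a a' b :
  induced_dom g a -> induced_dom g a' -> induced_dom h b ->
  skew_mul g h (k *: a + a') b = k *: skew_mul g h a b + skew_mul g h a' b.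
Proof.
move=> ha ha' _; rewrite /skew_mul papp_induced_inv_lin // mulrDl -kscalerAl.
by rewrite papp_induced_lin //; apply/induced_domMr/induced_inv_dom.
Qed.

Fact skew_mulPr g h k a b b' :
  induced_dom g a -> induced_dom h b -> induced_dom h b' ->
  skew_mul g h a (k *: b + b') = k *: skew_mul g h a b + skew_mul g h a b'.
Proof.
move=> ha _ _; rewrite /skew_mul mulrDr -kscalerAr.
by rewrite papp_induced_lin //; apply/induced_domMr/induced_inv_dom.
Qed.

Lemma skew_mulDl g h a a' b :
  induced_dom g a -> induced_dom g a' -> induced_dom h b ->
  skew_mul g h (a + a') b = skew_mul g h a b + skew_mul g h a' b.
Proof. by move=> ha ha' hb; have := skew_mulPl 1 ha ha' hb; rewrite !scale1r. Qed.

Lemma skew_mulDr g h a b b' :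
  induced_dom g a -> induced_dom h b -> induced_dom h b' ->
  skew_mul g h a (b + b') = skew_mul g h a b + skew_mul g h a b'.
Proof. by move=> ha hb hb'; have := skew_mulPr 1 ha hb hb'; rewrite !scale1r. Qed.

Lemma skew_mul0l g h b : skew_mul g h 0 b = 0.
Proof.
have [s] : exists s, sigma_class s = g by exists (repr g); rewrite /sigma_class reprK.
by move=> sg; rewrite (skew_mulE h b sg) ?mulr0 ?mul0r.
Qed.

Lemma skew_mul0r g h a : induced_dom g a -> skew_mul g h a 0 = 0.
Proof.
move=> ha; have := skew_mulDr ha (induced_dom0 h) (induced_dom0 h).
by rewrite addr0 => /eqP; rewrite -subr_eq subrr eq_sym => /eqP.
Qed.

Fact skew_mul_dom g h a b :
  induced_dom g a -> induced_dom h b -> induced_dom (g * h)%g (skew_mul g h a b).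
Proof.
move=> ha hb; move: a ha; apply: induced_dom_ind => [|x y hx hy|s x sg hx].
- by rewrite skew_mul0l; exact: induced_dom0.
- by rewrite skew_mulDl //; exact: induced_domD.
rewrite (skew_mulE h b sg hx).
move: b hb; apply: induced_dom_ind => [|y z hy hz|t y th ht].
- by rewrite al0 mulr0; exact: induced_dom0.
- by rewrite alD mulrDr; exact: induced_domD.
by rewrite -sg -th -sigma_classM; apply: induced_dom1; exact: al_dom hx ht.
Qed.

Fact skew_mulA g h j a b c :
  induced_dom g a -> induced_dom h b -> induced_dom j c ->
  skew_mul g (h * j)%g a (skew_mul h j b c) =
  skew_mul (g * h)%g j (skew_mul g h a b) c.
Proof.
move=> ha hb hc; move: a ha; apply: induced_dom_ind => [|x y hx hy|s x sg hx].
- by rewrite !skew_mul0l.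
- rewrite skew_mulDl //; last exact: skew_mul_dom.
  move=> -> ->; rewrite (skew_mulDl hx hy hb) [RHS]skew_mulDl //.
    exact: skew_mul_dom hx hb.
  exact: skew_mul_dom hy hb.
rewrite !(skew_mulE _ _ sg hx).
move: b hb; apply: induced_dom_ind => [|y z hy hz|t y th ht].
- by rewrite skew_mul0l al0 mulr0 skew_mul0l.
- have Dx : induced_dom g x by rewrite -sg; exact: induced_dom1.
  have Dy := skew_mul_dom Dx hy; rewrite (skew_mulE h y sg hx) in Dy.
  have Dz := skew_mul_dom Dx hz; rewrite (skew_mulE h z sg hx) in Dz.
  by move=> Ey Ez; rewrite (skew_mulDl hy hz hc) !alD !mulrDr Ey Ez skew_mulDl.
rewrite (skew_mulE _ _ th ht) (@skew_mulE (s * t)%g) ?sigma_classM ?sg ?th //.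
  by rewrite alM alA mulrA.
exact: al_dom.
Qed.

Fact skew_one : induced_dom 1%g 1.
Proof. by apply: (@induced_dom1 1%g); rewrite act_idem1 mulr1. Qed.

Fact skew_mul1 g a : induced_dom g a -> skew_mul 1%g g 1 a = a.
Proof.
by move=> _; rewrite (@skew_mulE 1%g) ?act_idem1 ?mulr1 // al1g mul1r.
Qed.

Fact skew_1mul g a : induced_dom g a -> skew_mul g 1%g a 1 = a.
Proof.
move: a; apply: induced_dom_ind => [|x y hx hy hx' hy'|s x sg hx].
- exact: skew_mul0l.
- by rewrite skew_mulDl ?hx' ?hy' //; exact: skew_one.
by rewrite (skew_mulE _ _ sg hx) al1 -act_idemC.
Qed.

Definition skew_twisting : twisting A (max_group_image S) :=
  Twisting induced_dom0 induced_dom_lin skew_mul_dom skew_mulPl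
    skew_mulPr skew_mulA skew_one skew_mul1 skew_1mul.

Definition skew_group_algebra : kalgType K := twisted_sum skew_twisting.


End UnitalAction.

(* Main.v *)
(* The map a delta_s |-> a delta_[s], where [s] is the sigma-class of s, is a  *)
(* surjective algebra map L(A, theta, S) -> A x| G(S) that kills N. For its    *)
(* kernel: if S is E-unitary and s, t are sigma-related, then u = s t^-1 t is  *)
(* below both s and t and 1_u = 1_s 1_t, so modulo N                           *)
(*   b delta_s = b delta_u = b delta_t  for every b in 1_s 1_t A.              *)
(* This allows rebuilding the class of an element modulo N from its image, one *)
(* s in the support at a time.                                                 *)

Require Import Defs.
From HB Require Import structures.
From mathcomp Require Import all_boot all_order all_algebra all_classical.

Set Implicit Arguments.
Unset Strict Implicit.
Unset Printing Implicit Defensive.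

Import GRing.Theory.

Local Open Scope quotient_scope.
Local Open Scope classical_set_scope.
Local Open Scope ring_scope.

(** The first isomorphism theorem ([kalg_isomorphic_quotient]) is applied to [crossed_to_skew],
    which only relabels each index by its sigma-class. It is onto because D_g is the sum of the 1_s
    A with s in g, and it kills the relators because s and t lie in one class when s <= t. The
    substance is that nothing else is killed. By [crossed_class_sigma], the ambiguity in writing an
    element of D_g as a sum of pieces from the 1_s A disappears modulo N. So for each x some finite
    list r makes [skew_to_crossed r] recover the class of x from its image ([crossed_to_skewK]).
    This map is additive, so a zero image forces a zero class. *)

Lemma kalg_isomorphic_quotient (K : comPzRingType) (L B : kalgType K)
    (X : set L) (phi : {rmorphism L -> B}) :
  scalable phi -> (forall y, exists x, phi x = y) ->
  (forall x, phi x = 0 <-> generated_ideal X x) ->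
  kalg_isomorphic (quotient_algebra X) B.
Proof.
move=> phiZ phi_surj phi_ker.
pose f (q : quotient_algebra X) : B := phi (repr q).
have fE x : f (\pi_(Quotient.quot (gen_ideal_pred X)) x) = phi x.
  apply/eqP; rewrite -subr_eq0 -rmorphB; apply/eqP/phi_ker.
  exact: quotient_reprP.
have fB : zmod_morphism f.
  move=> p q; elim/quotient_ind: p => x; elim/quotient_ind: q => y.
  by rewrite -(raddfB (\pi_(Quotient.quot (gen_ideal_pred X)))) !fE raddfB.
have fM : monoid_morphism f.
  split; first by rewrite fE rmorph1.
  move=> p q; elim/quotient_ind: p => x; elim/quotient_ind: q => y.
  transitivity (f (quotient_mul (\pi x) (\pi y))); first by [].
  by rewrite -pi_quotient_mul !fE rmorphM.
pose fA := GRing.isZmodMorphism.Build _ _ f fB.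
pose fR := GRing.isMonoidMorphism.Build _ _ f fM.
pose F : {rmorphism quotient_algebra X -> B} := HB.pack f fA fR.
exists F; split.
  move=> k q; elim/quotient_ind: q => x.
  transitivity (f (quotient_scale k (\pi x))); first by [].
  by rewrite -pi_quotient_scale /= !fE phiZ.
(* Any choice of preimages serves as inverse, since two preimages differ by an element of the
   ideal. *)
pose psi y := projT1 (cid (phi_surj y)).
have psiK y : phi (psi y) = y by rewrite /psi; case: cid.
exists (fun y => \pi_(Quotient.quot (gen_ideal_pred X)) (psi y)) => [q|y].
  elim/quotient_ind: q => x; rewrite /= fE; apply/quotient_eqP/phi_ker.
  by rewrite rmorphB psiK subrr.
by rewrite /= fE psiK.
Qed.

(** * Relabelling the indices of a twisted sum along a monoid morphism *)

Section Pushforward.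
Variables (K : comPzRingType) (A : kalgType K) (M N : monoidType).
Variables (T : twisting A M) (U : twisting A N) (f : M -> N).
Hypothesis f1 : f 1%g = 1%g.
Hypothesis fM : {morph f : g h / (g * h)%g}.
Hypothesis f_dom : forall g, tw_dom T g `<=` tw_dom U (f g).
Hypothesis f_mul : forall g h a b, tw_dom T g a -> tw_dom T h b ->
  tw_mul U (f g) (f h) a b = tw_mul T g h a b.
Implicit Types x y : twisted_sum T.

Definition push_coef x : N -> A := \sum_(g \in [set: M]) dirac (f g) (x g).

(** Any list containing the support may be used, so several elements can be compared term by term
    over one common list. *)
Lemma push_coefE (r : seq M) x : uniq r -> (forall g, g \notin r -> x g = 0) ->
  push_coef x = \sum_(g <- r) dirac (f g) (x g).
Proof.
move=> ur hx; rewrite /push_coef (fsbigE r) //=.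
  by apply: eq_bigl => g; rewrite in_setT.
by move=> g _; have [//|/hx ->] := boolP (g \in r); rewrite dirac0.
Qed.

Fact push_coef_pred x : push_coef x \in twisted_sum_pred U.
Proof.
have [r ur hx] := tw_support x; rewrite (push_coefE ur hx).
have [p0 _] := twisted_sum_submod U.
elim/big_ind: _ => // [|g _]; first exact: twisted_sum_predD.
exact/dirac_pred/f_dom/twisted_sumP.
Qed.

Definition push x : twisted_sum U := TwistedSum (push_coef_pred x).

Lemma push_delta g a (Da : tw_dom T g a) : push (delta Da) = delta (f_dom Da).
Proof.
apply: val_inj; rewrite /= (@push_coefE [:: g]) //=.
  by rewrite big_seq1 dirac_eq.
by move=> h; rewrite inE; exact: dirac_ne.
Qed.

Lemma push_lin k x y : push (k *: x + y) = k *: push x + push y.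
Proof.
have [r [ur hx hy _]] := tw_support3 x y x.
have hxy g : g \notin r -> (k *: x + y) g = 0.
  move=> gr; rewrite [LHS](_ : _ = k *: x g + y g) //.
  by rewrite hx // hy // scaler0 addr0.
apply: val_inj; rewrite [RHS](_ : _ = k *: push_coef x + push_coef y) //.
rewrite /= (push_coefE ur hxy) (push_coefE ur hx) (push_coefE ur hy).
rewrite scaler_sumr -big_split; apply: eq_bigr => g _ /=.
by rewrite -diracP.
Qed.

Fact push_additive : zmod_morphism push.
Proof.
by move=> x y; rewrite addrC -scaleN1r push_lin scaleN1r addrC.
Qed.

HB.instance Definition _ := GRing.isZmodMorphism.Build _ _ push push_additive.

Fact push_monoid_morphism : monoid_morphism push.
Proof.
have pushD x y : push (x + y) = push x + push y by exact: raddfD.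
have push0 : push 0 = 0 by exact: raddf0.
split.
  transitivity (push (delta (tw_one T))); first by [].
  by rewrite push_delta; apply: val_inj; rewrite /= f1.
move=> x y; elim/twisted_sum_ind: x => [|x x' IH IH'|g a Da].
- by rewrite mul0r push0 mul0r.
- by rewrite mulrDl !pushD IH IH' mulrDl.
elim/twisted_sum_ind: y => [|y y' IH IH'|h b Db].
- by rewrite mulr0 push0 mulr0.
- by rewrite mulrDr !pushD IH IH' mulrDr.
rewrite !push_delta [in LHS]/GRing.mul [in RHS]/GRing.mul /=.
rewrite !twisted_mul_delta push_delta; apply: val_inj => /=.
by rewrite f_mul // fM.
Qed.

Definition push_rmorphism : {rmorphism twisted_sum T -> twisted_sum U} :=
  HB.pack push (GRing.isZmodMorphism.Build _ _ push push_additive)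
    (GRing.isMonoidMorphism.Build _ _ push push_monoid_morphism).

Lemma push_scalable : scalable push.
Proof. by move=> k x; rewrite -[k *: x]addr0 push_lin raddf0 addr0. Qed.

End Pushforward.

(** * The surjection from L(A, theta, S) onto the skew group algebra *)

Section CrossedToSkew.
Variables (K : comPzRingType) (S : inverseMonoidType) (A : kalgType K).
Variables (theta : unital_action S A) (EuS : E_unitary S).
Local Notation "1_[ s ]" := (act_idem theta s) (format "1_[ s ]").
Local Notation "s ^*" := (sinv s) : group_scope.
Local Notation compat := (E_unitary_compatible (theta := theta) EuS).
Local Notation T := (crossed_twisting theta).
Local Notation U := (skew_twisting compat).
Local Notation L := (crossed_sum theta).
Local Notation N := (@crossed_relators S K A theta).
Local Notation pi :=
  (\pi_(Quotient.quot (gen_ideal_pred N)) : L -> crossed_product theta).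
Implicit Types (s t : S) (a b : A).

(** A common lower bound u gives u u^-1 <= s t^-1, and E-unitarity passes idempotency upwards. *)
Lemma idempotent_sigma_mulV s t : sigma s t -> idempotent_elt (s * t^*)%g.
Proof.
move=> [u us ut]; apply: (EuS (idem_mulsV u)).
exact: nat_le_mul us (nat_le_sinv ut).
Qed.

(** Evaluate theta at s t^-1 t on 1: the inner factors give 1_(t^-1), which theta_s sends to 1_s 1_t
    by compatibility. *)
Lemma act_idem_meet s t : sigma s t -> 1_[(s * t^* * t)%g] = 1_[s] * 1_[t].
Proof.
move=> st; rewrite -al1 -!alA al1.
have := al_idemV theta t^*%g; rewrite sinvK => ->.
by have := compat_idem compat (sigmaV st); rewrite !sinvK => <-.
Qed.

Lemma act_idem_le s t : nat_le s t -> 1_[t] * 1_[s] = 1_[s].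
Proof.
(* With s = e t one has s t^-1 t = s, so the meet formula reads 1_s = 1_s 1_t. *)
move=> [e ee ->]; rewrite act_idemC -act_idem_meet.
  by rewrite -mulgA -mulgA (mulgA t) mulsVs.
exists (e * t)%g; first exact: nat_le_refl.
by exists e.
Qed.

Lemma crossed_dom_sigma s : tw_dom T s `<=` tw_dom U (sigma_class s).
Proof. by move=> a /crossed_domP; exact: induced_dom1. Qed.

Lemma skew_mul_crossed s t a b : tw_dom T s a -> tw_dom T t b ->
  tw_mul U (sigma_class s) (sigma_class t) a b = tw_mul T s t a b.
Proof. by move=> /crossed_domP sa _; exact: skew_mulE. Qed.

Definition crossed_to_skew : {rmorphism L -> skew_group_algebra compat} :=
  push_rmorphism (erefl : sigma_class (1 : S)%g = 1%g) (@sigma_classM S)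
    (@crossed_dom_sigma) skew_mul_crossed.

Lemma crossed_to_skew_delta s a (Da : tw_dom T s a) :
  crossed_to_skew (delta Da) = delta (crossed_dom_sigma Da).
Proof. exact: push_delta. Qed.

Lemma crossed_to_skew_surj y : exists x, crossed_to_skew x = y.
Proof.
elim/twisted_sum_ind: y => [|y y' [x <-] [x' <-]|g a Da].
- by exists 0; rewrite rmorph0.
- by exists (x + x'); rewrite rmorphD.
suff [x xE] : exists x, crossed_to_skew x = dirac g a :> (_ -> A).
  by exists x; apply: val_inj.
move: a Da; apply: induced_dom_ind => [|a b _ _ [x xE] [y yE]|s a <- sa].
- by exists 0; rewrite rmorph0 dirac0.
- exists (x + y); rewrite rmorphD.
  by have := diracP g 1 a b; rewrite !scale1r -xE -yE => ->.
have Da : tw_dom T s a by apply/crossed_domP.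
by exists (delta Da); rewrite crossed_to_skew_delta.
Qed.

Lemma crossed_to_skew_relator x : N x -> crossed_to_skew x = 0.
Proof.
move=> [s [t [a [st Da xE]]]].
have Dsa : tw_dom T s a by [].
have Dta : tw_dom T t a.
  apply/crossed_domP; have /crossed_domP <- := Da.
  by rewrite mulrA act_idem_le.
have -> : x = delta Dsa - delta Dta by apply: val_inj.
rewrite rmorphB !crossed_to_skew_delta; apply/eqP; rewrite subr_eq0; apply/eqP.
apply: val_inj => /=; congr dirac; apply/sigma_classP.
by exists s => //; exact: nat_le_refl.
Qed.

(** * Classes modulo N and the kernel *)

Fact crossed_dom_idem s a : tw_dom T s (1_[s] * a).
Proof. by exists a. Qed.

(** Multiplying by 1_s makes the class defined for every a, so no membership proof has to be carried
    along. *)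
Definition crossed_class s a : crossed_product theta :=
  pi (delta (crossed_dom_idem s a)).

Lemma crossed_class_delta s a (Da : tw_dom T s a) :
  pi (delta Da) = crossed_class s a.
Proof.
congr pi; apply: val_inj => /=; congr dirac.
by have /crossed_domP := Da.
Qed.

Lemma crossed_classD s a b :
  crossed_class s (a + b) = crossed_class s a + crossed_class s b.
Proof.
rewrite /crossed_class -pi_quotient_add; congr pi; apply: val_inj => /=.
have := diracP s 1 (1_[s] * a) (1_[s] * b).
by rewrite !scale1r mulrDr.
Qed.

Lemma crossed_class0 s : crossed_class s 0 = 0.
Proof.
by apply: (addrI (crossed_class s 0)); rewrite -crossed_classD !addr0.
Qed.

Lemma crossed_class_le s t a : nat_le s t ->
  crossed_class s a = crossed_class t (1_[s] * a).
Proof.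
move=> st; apply/quotient_eqP => J _ NJ; apply: NJ.
exists s, t, (1_[s] * a); split=> //.
suff -> : dirac t (1_[s] * a) = dirac t (1_[t] * (1_[s] * a)) by [].
by rewrite mulrA act_idem_le.
Qed.

Lemma crossed_class_sigma s t a : sigma s t ->
  crossed_class s (1_[t] * a) = crossed_class t (1_[s] * a).
Proof.
move=> st; set u := (s * t^* * t)%g.
have us : nat_le u s.
  (* Conjugation by s moves the idempotent t^-1 t from the right of s to its left. *)
  exists (s * (t^* * t) * s^*)%g; first exact/idem_conj/idem_mulVs.
  by rewrite /u -mulgA [LHS]idem_slide //; exact: idem_mulVs.
have ut : nat_le u t by exists (s * t^*)%g => //; exact: idempotent_sigma_mulV.
have uE : 1_[u] = 1_[s] * 1_[t] := act_idem_meet st.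
have idem v b : crossed_class v (1_[v] * b) = crossed_class v b.
  exact/esym/crossed_class_le/nat_le_refl.
transitivity (crossed_class u a).
  by rewrite (crossed_class_le _ us) uE -mulrA idem.
by rewrite (crossed_class_le _ ut) uE act_idemC -mulrA idem.
Qed.

(* Since crossed_class s (1_t a) = crossed_class t (1_s a), peeling off the    *)
(* part of b supported in 1_s A for each s in r in turn sends a delta_t to its *)
(* class for every t in r, although b only remembers the sigma-class of t.     *)
Fixpoint skew_to_crossed (r : seq S) (b : max_group_image S -> A) :
    crossed_product theta :=
  if r is s :: r' then
    let a := b (sigma_class s) in
    crossed_class s a +
      skew_to_crossed r' (b - dirac (sigma_class s) (1_[s] * a))
  else 0.

Lemma skew_to_crossedD r (b b' : max_group_image S -> A) :
  skew_to_crossed r (b + b') = skew_to_crossed r b + skew_to_crossed r b'.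
Proof.
elim: r b b' => [|s r IH] b b' /=; first by rewrite addr0.
rewrite [(b + b') _](_ : _ = b (sigma_class s) + b' (sigma_class s)) //.
rewrite crossed_classD addrACA -IH mulrDr.
have := diracP (sigma_class s) 1
  (1_[s] * b (sigma_class s)) (1_[s] * b' (sigma_class s)).
by rewrite !scale1r => ->; rewrite opprD addrACA.
Qed.

Lemma skew_to_crossed0 r : skew_to_crossed r 0 = 0.
Proof.
have := skew_to_crossedD r 0 0; rewrite addr0 => /eqP.
by rewrite -subr_eq subrr eq_sym => /eqP.
Qed.

Lemma skew_to_crossed_dirac r t a : t \in r -> 1_[t] * a = a ->
  skew_to_crossed r (dirac (sigma_class t) a) = crossed_class t a.
Proof.
elim: r a => [|s r IH] a //; rewrite inE /= => tsr ta.
have [st|st] := eqVneq (sigma_class s) (sigma_class t); last first.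
  rewrite dirac_ne // crossed_class0 mulr0 dirac0 subr0 add0r IH //.
  by case/predU1P: tsr st => // ->; rewrite eqxx.
rewrite st dirac_eq.
have -> : dirac (sigma_class t) a - dirac (sigma_class t) (1_[s] * a) =
    dirac (sigma_class t) (a - 1_[s] * a).
  have := diracP (sigma_class t) (-1) (1_[s] * a) a.
  by rewrite !scaleN1r (addrC _ a) => ->; rewrite addrC.
(* The head contributes the class of (1_s a) delta_t and the tail that of (a - 1_s a) delta_t. If t
   is not in the tail, then s = t and nothing remains. *)
have [t_r|] := boolP (t \in r).
  rewrite IH //; last by rewrite mulrBr ta idemCA ta.
  rewrite -{1}ta crossed_class_sigma; last exact/sigma_classP.
  by rewrite -crossed_classD addrC subrK.
move=> /negPf tr; move: tsr; rewrite tr orbF => /eqP <-.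
by rewrite ta subrr dirac0 skew_to_crossed0 addr0.
Qed.

(** Allowing every larger list r lets two summands be treated with one list. *)
Lemma crossed_to_skewK x : exists r0 : seq S,
  forall r, {subset r0 <= r} -> skew_to_crossed r (crossed_to_skew x) = pi x.
Proof.
elim/twisted_sum_ind: x => [|x y [rx hx] [ry hy]|s a Da].
- by exists [::] => r _; rewrite rmorph0 skew_to_crossed0 raddf0.
- exists (rx ++ ry) => r rxy; rewrite rmorphD skew_to_crossedD pi_quotient_add.
  by rewrite hx ?hy // => s sr; apply: rxy; rewrite mem_cat sr ?orbT.
exists [:: s] => r sr; rewrite crossed_class_delta crossed_to_skew_delta /=.
by rewrite skew_to_crossed_dirac ?sr ?mem_head //; apply/crossed_domP.
Qed.

Lemma crossed_to_skew_ker x : crossed_to_skew x = 0 <-> generated_ideal N x.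
Proof.
split=> [x0|]; last first.
  move=> /(_ [set y | crossed_to_skew y = 0]); apply; last first.
    exact: crossed_to_skew_relator.
  split=> [|y z y0 z0|y z z0]; rewrite /mkset ?rmorph0 //.
    by rewrite rmorphB y0 z0 subrr.
  by rewrite !rmorphM z0 mulr0 mul0r.
suff : pi x = pi 0 by move=> /quotient_eqP; rewrite subr0.
have [r /(_ r) <- //] := crossed_to_skewK x.
by rewrite x0 skew_to_crossed0 raddf0.
Qed.

End CrossedToSkew.

Theorem corollary2p13 (K : comPzRingType) (S : inverseMonoidType)
    (A : kalgType K) (theta : unital_action S A) (EuS : E_unitary S) :
  kalg_isomorphic (crossed_product theta)
    (skew_group_algebra (E_unitary_compatible (theta := theta) EuS)).
Proof.
apply: (kalg_isomorphic_quotient (phi := crossed_to_skew theta EuS)).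
- exact: push_scalable.
- exact: crossed_to_skew_surj.
- exact: crossed_to_skew_ker.
Qed.
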